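(* Let $P_1$ and $P_2$ be extended logic programs, let $\mathcal{A}$ be the set of atoms occurring in $P_1\cup P_2$, and suppose $P_2$ is tau-comp with respect to $\mathcal{A}$. Then the update answer sets of $(P_1,P_2)$ (i.e. the sets $S'\cap Lit_{\mathcal{A}}$ for $S'$ an answer set of $P_1\oplus_1 P_2$) are exactly the answer sets of $P_1\oplus_2 P_2$.
   Context: Formulas use $\wedge,\vee,\rightarrow,\bot$ and strong negation $\sim$; $\lnot F$ is $F\rightarrow\bot$, $\top$ is $\bot\rightarrow\bot$. A literal is an atom $a$ or $\sim a$; for a literal $L$, $\sim L$ denotes its complement ($\sim\sim a=a$). $Lit_{\mathcal{A}}$ is the set of literals over atoms $\mathcal{A}$. An extended logic program (ELP) is a finite set of rules $r$ of the form $L\leftarrow B_1,\dots,B_m,\lnot B_{m+1},\dots,\lnot B_n$ (the formula $B_1\wedge\dots\wedge\lnot B_n\rightarrow L$) with $L$ and the $B_i$ literals, $\top$ or $\bot$; $H(r)=L$, $B(r)$ is the body conjunction; $r$ is a constraint if $H(r)=\bot$. $P$ is tau-comp w.r.t. $\mathcal{A}$ if every rule $l\leftarrow l$ with $l\in Lit_{\mathcal{A}}$ belongs to $P$. $\mathrm{N}_2$ is intuitionistic logic plus Nelson's strong-negation axioms ($\sim(\alpha\rightarrow\beta)\leftrightarrow\alpha\wedge\sim\beta$, $\sim(\alpha\wedge\beta)\leftrightarrow\sim\alpha\vee\sim\beta$, $\sim(\alpha\vee\beta)\leftrightarrow\sim\alpha\wedge\sim\beta$, $\alpha\leftrightarrow\sim\sim\alpha$,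 $\sim\lnot\alpha\leftrightarrow\alpha$, $\sim a\rightarrow\lnot a$ for atoms) and the schema $\alpha\vee(\alpha\rightarrow\beta)\vee\lnot\beta$. For a finite set of formulas $T$ over atoms $\mathcal{B}$, a consistent (no $a$ and $\sim a$ together) $M\subseteq Lit_{\mathcal{B}}$ is an answer set of $T$ iff $T\cup\{\lnot l:l\in Lit_{\mathcal{B}}\setminus M\}\cup\{\lnot\lnot l:l\in M\}$ is $\mathrm{N}_2$-consistent and $\mathrm{N}_2$-derives every element of $M$. Operator $\oplus_1$: extend $\mathcal{A}$ with fresh pairwise distinct atoms $rej(r)$ for each rule $r$ (rules of $P_1$ and $P_2$ named distinctly) and $A_1,A_2$ for each $A\in\mathcal{A}$; for a literal $L$, $L_i$ replaces the atom $A$ of $L$ by $A_i$. $P_1\oplus_1P_2$ consists of: (i) all constraints of $P_1\cup P_2$; (ii) for each non-constraint $r\in P_1$ with $H(r)=L$: $L_1\leftarrow B(r),\lnot rej(r)$ and $rej(r)\leftarrow B(r),\sim L_2$; (iii) for each non-constraint $r\in P_2$ with $H(r)=L$: $L_2\leftarrow B(r)$; (iv) for each literal $L$ occurring in $P_1$ or $P_2$: $L_1\leftarrow L_2$ and $L\leftarrow L_1$. Operator $\oplus_2$: $P_1\oplus_2P_2$ consists of (i) all constraints of $P_1\cup P_2$; (ii) for each non-constraint $r\in P_1$ with $H(r)=L$: $L\leftarrow B(r),\lnot\sim L$; (iii) all rules of $P_2$. *)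

(* Defs.v *)
From HB Require Import structures.
From mathcomp Require Import all_boot finmap.

Set Implicit Arguments.
Unset Strict Implicit.
Unset Printing Implicit Defensive.

Local Open Scope fset_scope.

Inductive formula (A : Type) : Type :=
| Atom of A
| Bot
| And of formula A & formula A
| Or of formula A & formula A
| Imp of formula A & formula A
| SNeg of formula A.

Arguments Bot {A}.

Definition Not (A : Type) (F : formula A) : formula A := Imp F Bot.
Definition Top (A : Type) : formula A := Imp Bot Bot.
Definition Iff (A : Type) (F G : formula A) : formula A :=
  And (Imp F G) (Imp G F).
Arguments Top {A}.

Inductive N2_derives (A : Type) (T : formula A -> Prop) : formula A -> Prop :=
| N2_hyp F : T F -> N2_derives T F
| N2_mp F G : N2_derives T (Imp F G) -> N2_derives T F -> N2_derives T G
| N2_K F G : N2_derives T (Imp F (Imp G F))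
| N2_S F G H :
    N2_derives T (Imp (Imp F (Imp G H)) (Imp (Imp F G) (Imp F H)))
| N2_andI F G : N2_derives T (Imp F (Imp G (And F G)))
| N2_andE1 F G : N2_derives T (Imp (And F G) F)
| N2_andE2 F G : N2_derives T (Imp (And F G) G)
| N2_orI1 F G : N2_derives T (Imp F (Or F G))
| N2_orI2 F G : N2_derives T (Imp G (Or F G))
| N2_orE F G H :
    N2_derives T (Imp (Imp F H) (Imp (Imp G H) (Imp (Or F G) H)))
| N2_botE F : N2_derives T (Imp Bot F)
| N2_sneg_imp F G : N2_derives T (Iff (SNeg (Imp F G)) (And F (SNeg G)))
| N2_sneg_and F G :
    N2_derives T (Iff (SNeg (And F G)) (Or (SNeg F) (SNeg G)))
| N2_sneg_or F G :
    N2_derives T (Iff (SNeg (Or F G)) (And (SNeg F) (SNeg G)))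
| N2_sneg_sneg F : N2_derives T (Iff F (SNeg (SNeg F)))
| N2_sneg_not F : N2_derives T (Iff (SNeg (Not F)) F)
| N2_sneg_atom a : N2_derives T (Imp (SNeg (Atom a)) (Not (Atom a)))
| N2_ht F G : N2_derives T (Or F (Or (Imp F G) (Not G))).

Definition N2_consistent (A : Type) (T : formula A -> Prop) : Prop :=
  ~ N2_derives T Bot.

Inductive literal (A : Type) : Type := PosL of A | NegL of A.

Definition atom_of (A : Type) (l : literal A) : A :=
  match l with PosL a => a | NegL a => a end.

Definition compl (A : Type) (l : literal A) : literal A :=
  match l with PosL a => NegL a | NegL a => PosL a end.

Definition lmap (A B : Type) (f : A -> B) (l : literal A) : literal B :=
  match l with PosL a => PosL (f a) | NegL a => NegL (f a) end.

Definition literal_form (A : Type) (l : literal A) : formula A :=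
  match l with PosL a => Atom a | NegL a => SNeg (Atom a) end.

Definition literal_encode (A : Type) (l : literal A) : A + A :=
  match l with PosL a => inl a | NegL a => inr a end.
Definition literal_decode (A : Type) (s : A + A) : literal A :=
  match s with inl a => PosL a | inr a => NegL a end.
Lemma literal_encodeK (A : Type) :
  cancel (@literal_encode A) (@literal_decode A).
Proof. by case. Qed.
HB.instance Definition _ (A : choiceType) :=
  Choice.copy (literal A) (can_type (@literal_encodeK A)).

Definition Lits (A : choiceType) (B : {fset A}) : {fset literal A} :=
  [fset PosL a | a in B] `|` [fset NegL a | a in B].

Definition consistent_lits (A : choiceType) (M : {fset literal A}) : Prop :=
  forall l, l \in M -> compl l \notin M.

Definition completion (A : choiceType) (B : {fset A}) (T : formula A -> Prop)
    (M : {fset literal A}) (F : formula A) : Prop :=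
  [\/ T F,
      exists2 l, l \in Lits B `\` M & F = Not (literal_form l)
    | exists2 l, l \in M & F = Not (Not (literal_form l))].

Definition answer_set (A : choiceType) (B : {fset A}) (T : formula A -> Prop)
    (M : {fset literal A}) : Prop :=
  [/\ M `<=` Lits B,
      consistent_lits M,
      N2_consistent (completion B T M)
    & forall l, l \in M -> N2_derives (completion B T M) (literal_form l)].

(* Heads and body elements: a literal, or one of the constants. *)
Inductive basic (A : Type) : Type := BTop | BBot | BLit of literal A.
Arguments BTop {A}.
Arguments BBot {A}.

Definition basic_form (A : Type) (b : basic A) : formula A :=
  match b with BTop => Top | BBot => Bot | BLit l => literal_form l end.

(* The complement of a constant is the constant that is N_2-equivalent to its
   strong negation. *)
Definition bcompl (A : Type) (b : basic A) : basic A :=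
  match b with BTop => BBot | BBot => BTop | BLit l => BLit (compl l) end.

Definition bmap (A B : Type) (f : A -> B) (b : basic A) : basic B :=
  match b with BTop => BTop | BBot => BBot | BLit l => BLit (lmap f l) end.

Definition basic_encode (A : Type) (b : basic A) : bool + literal A :=
  match b with BTop => inl true | BBot => inl false | BLit l => inr l end.
Definition basic_decode (A : Type) (s : bool + literal A) : basic A :=
  match s with inl c => if c then BTop else BBot | inr l => BLit l end.
Lemma basic_encodeK (A : Type) : cancel (@basic_encode A) (@basic_decode A).
Proof. by case. Qed.
HB.instance Definition _ (A : choiceType) :=
  Choice.copy (basic A) (can_type (@basic_encodeK A)).

(* [Rule L [:: B_1; ..; B_m] [:: B_m+1; ..; B_n]] is the rule
   L <- B_1, .., B_m, not B_m+1, .., not B_n *)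
Record rule (A : Type) : Type := Rule {
  rhead : basic A;
  pbody : seq (basic A);
  nbody : seq (basic A) }.

Definition rule_encode (A : Type) (r : rule A) :
    basic A * seq (basic A) * seq (basic A) :=
  (rhead r, pbody r, nbody r).
Definition rule_decode (A : Type)
    (t : basic A * seq (basic A) * seq (basic A)) : rule A :=
  Rule t.1.1 t.1.2 t.2.
Lemma rule_encodeK (A : Type) : cancel (@rule_encode A) (@rule_decode A).
Proof. by case. Qed.
HB.instance Definition _ (A : choiceType) :=
  Choice.copy (rule A) (can_type (@rule_encodeK A)).

Notation program A := {fset rule A}.

Definition body_conj (A : Type) (s : seq (formula A)) : formula A :=
  if s is F :: s' then foldl (@And A) F s' else Top.

Definition rule_form (A : Type) (r : rule A) : formula A :=
  Imp (body_conj (map (@basic_form A) (pbody r)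
             ++ map (fun b => Not (basic_form b)) (nbody r)))
      (basic_form (rhead r)).

Definition rule_map (A B : Type) (f : A -> B) (r : rule A) : rule B :=
  Rule (bmap f (rhead r)) (map (bmap f) (pbody r)) (map (bmap f) (nbody r)).

Definition is_constraint (A : choiceType) (r : rule A) : bool :=
  rhead r == BBot.

Definition constraints (A : choiceType) (P : program A) : program A :=
  [fset r in P | is_constraint r].

Definition proper_rules (A : choiceType) (P : program A) : program A :=
  [fset r in P | ~~ is_constraint r].

Definition rule_lits (A : choiceType) (r : rule A) : seq (literal A) :=
  pmap (fun b => if b is BLit l then Some l else None)
       (rhead r :: pbody r ++ nbody r).

Definition prog_lits (A : choiceType) (P : program A) : {fset literal A} :=
  [fset l | r in P, l in rule_lits r].

Definition prog_atoms (A : choiceType) (P : program A) : {fset A} :=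
  [fset atom_of l | l in prog_lits P].

Definition prog_theory (A : choiceType) (P : program A) (F : formula A) :
    Prop :=
  exists2 r, r \in P & F = rule_form r.

Definition tau_comp (A : choiceType) (B : {fset A}) (P : program A) : Prop :=
  forall l, l \in Lits B -> Rule (BLit l) [:: BLit l] [::] \in P.

(* The extended alphabet. [Rej false r] and [Rej true r] are the atoms rej(r)
   for r as a rule of P_1 and of P_2 respectively, so that the two programs'
   rules are named distinctly even when they share a rule; [Idx false a] and
   [Idx true a] are the indexed copies a_1 and a_2. *)
Inductive xatom (A : Type) : Type :=
| Base of A
| Rej of bool & rule A
| Idx of bool & A.

Definition xatom_encode (A : Type) (x : xatom A) :
    A + (bool * rule A) + (bool * A) :=
  match x with
  | Base a => inl (inl a)
  | Rej i r => inl (inr (i, r))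
  | Idx i a => inr (i, a)
  end.
Definition xatom_decode (A : Type) (s : A + (bool * rule A) + (bool * A)) :
    xatom A :=
  match s with
  | inl (inl a) => Base a
  | inl (inr (i, r)) => Rej i r
  | inr (i, a) => Idx i a
  end.
Lemma xatom_encodeK (A : Type) : cancel (@xatom_encode A) (@xatom_decode A).
Proof. by case. Qed.
HB.instance Definition _ (A : choiceType) :=
  Choice.copy (xatom A) (can_type (@xatom_encodeK A)).

Notation idx1 := (bmap (Idx false)).
Notation idx2 := (bmap (Idx true)).

Definition base_rule (A : Type) : rule A -> rule (xatom A) :=
  rule_map (@Base A).

Definition rej1 (A : Type) (r : rule A) : basic (xatom A) :=
  BLit (PosL (Rej false r)).

(* L_1 <- B(r), not rej(r) *)
Definition inertia_rule (A : Type) (r : rule A) : rule (xatom A) :=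
  Rule (idx1 (rhead r)) (pbody (base_rule r))
       (rcons (nbody (base_rule r)) (rej1 r)).

(* rej(r) <- B(r), ~L_2 *)
Definition rejection_rule (A : Type) (r : rule A) : rule (xatom A) :=
  Rule (rej1 r) (rcons (pbody (base_rule r)) (bcompl (idx2 (rhead r))))
       (nbody (base_rule r)).

(* L_2 <- B(r) *)
Definition update_rule (A : Type) (r : rule A) : rule (xatom A) :=
  Rule (idx2 (rhead r)) (pbody (base_rule r)) (nbody (base_rule r)).

(* L_1 <- L_2 *)
Definition link_rule (A : Type) (l : literal A) : rule (xatom A) :=
  Rule (BLit (lmap (Idx false) l)) [:: BLit (lmap (Idx true) l)] [::].

(* L <- L_1 *)
Definition output_rule (A : Type) (l : literal A) : rule (xatom A) :=
  Rule (BLit (lmap (@Base A) l)) [:: BLit (lmap (Idx false) l)] [::].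

Definition oplus1 (A : choiceType) (P1 P2 : program A) : program (xatom A) :=
  [fset base_rule r | r in constraints (P1 `|` P2)]
  `|` [fset inertia_rule r | r in proper_rules P1]
  `|` [fset rejection_rule r | r in proper_rules P1]
  `|` [fset update_rule r | r in proper_rules P2]
  `|` [fset link_rule l | l in prog_lits (P1 `|` P2)]
  `|` [fset output_rule l | l in prog_lits (P1 `|` P2)].

(* L <- B(r), not ~L *)
Definition defeasible_rule (A : Type) (r : rule A) : rule A :=
  Rule (rhead r) (pbody r) (rcons (nbody r) (bcompl (rhead r))).

Definition oplus2 (A : choiceType) (P1 P2 : program A) : program A :=
  constraints (P1 `|` P2)
  `|` [fset defeasible_rule r | r in proper_rules P1]
  `|` P2.

Definition xalphabet (A : choiceType) (P1 P2 : program A) :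
    {fset xatom A} :=
  [fset Base a | a in prog_atoms (P1 `|` P2)]
  `|` [fset Rej false r | r in P1]
  `|` [fset Rej true r | r in P2]
  `|` [fset Idx false a | a in prog_atoms (P1 `|` P2)]
  `|` [fset Idx true a | a in prog_atoms (P1 `|` P2)].

Definition base_part (A : choiceType) (B : {fset A})
    (S' : {fset literal (xatom A)}) : {fset literal A} :=
  [fset l in Lits B | lmap (@Base A) l \in S'].

Definition update_answer_set (A : choiceType) (P1 P2 : program A)
    (S : {fset literal A}) : Prop :=
  exists2 S', answer_set (xalphabet P1 P2) (prog_theory (oplus1 P1 P2)) S'
            & S = base_part (prog_atoms (P1 `|` P2)) S'.

(* Main.v *)
(** An answer set of a program is a consistent model [M] contained in every
    [H `<=` M] that is closed under the reduct of the program with respect to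
    [M].  One half is soundness of N_2 for here-and-there models with strong
    negation; for the other, the elements of [M] derivable from the completion
    form a set closed under the reduct.

    Since [P2] contains every rule [l <- l], an answer set of [oplus1 P1 P2]
    contains either all or none of [l], [l_1], [l_2], and it contains [rej(r)]
    iff the body of [r] and the complement of its head hold.  Hence it is
    determined by its base part.  Both programs block a rule [r] of [P1] when the
    complement of its head holds, except that [oplus1] keeps it if moreover the
    body of [r] fails; but then [r] does not fire in any subset either. *)

From Stdlib Require List.
Require Import Defs.
From mathcomp Require Import all_boot finmap boolp.

Local Open Scope fset_scope.

(** Formulas carry no [eqType] structure here, so conjuncts are listed with [List.In]; this leads
    back to [\in] for basic elements. *)
Lemma In_mem (T : eqType) (x : T) (s : seq T) : List.In x s -> x \in s.
Proof.
by elim: s => //= y s IH [->|/IH xs]; rewrite inE ?eqxx ?xs ?orbT.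
Qed.

(** * Here-and-there models with strong negation *)

Section HereAndThere.
Context {A : choiceType}.
Implicit Types (H M : {fset literal A}) (F G : formula A) (T : formula A -> Prop).

(* World [false] is "here" and [true] is "there"; polarity [false] is
   falsification, the forcing clause of the strong negation. *)
Fixpoint sat H M (pol w : bool) F : bool :=
  match F with
  | Atom a => (if pol then PosL a else NegL a) \in (if w then M else H)
  | Bot => ~~ pol
  | And F G => if pol then sat H M pol w F && sat H M pol w G
               else sat H M pol w F || sat H M pol w G
  | Or F G => if pol then sat H M pol w F || sat H M pol w G
              else sat H M pol w F && sat H M pol w G
  | Imp F G =>
      if pol then (sat H M true true F ==> sat H M true true G)
                  && (w || (sat H M true false F ==> sat H M true false G))
      else sat H M true w F && sat H M false w G
  | SNeg F => sat H M (~~ pol) w F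
  end.

Lemma sat_persistent H M pol F :
  H `<=` M -> sat H M pol false F -> sat H M pol true F.
Proof.
move=> /fsubsetP sHM; elim: F pol => [a||F IF G IG|F IF G IG|F IF G IG|F IF] pol /=.
- exact: sHM.
- by [].
- by case: pol => [/andP[/IF -> /IG ->]|/orP[/IF ->|/IG ->]]; rewrite ?orbT.
- by case: pol => [/orP[/IF ->|/IG ->]|/andP[/IF -> /IG ->]]; rewrite ?orbT.
- by case: pol => /andP[]; [move=> -> | move=> /IF -> /IG ->].
- exact: IF.
Qed.

(** Persistence turns every axiom but one into a Boolean check on the values of its subformulas at
    the two worlds. Only [~a -> not a] uses the consistency of [M], which [H] inherits. *)
Lemma N2_sound H M T F :
    H `<=` M -> consistent_lits M -> (forall G, T G -> sat H M true false G) ->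
  N2_derives T F -> sat H M true false F.
Proof.
move=> sHM cM satT.
have P pol G := sat_persistent H M pol G sHM.
have /fsubsetP sub := sHM.
elim=> {F} [F /satT //|F G _ /= /andP[_ /implyP] //|||||||||||||||a|]; last 2 first.
- rewrite /= andbT; apply/andP; split; apply/implyP.
    by move/cM/negbTE=> /= ->.
  move/sub/cM => /= nM; rewrite (negbTE nM) /= implybF.
  by apply: contra nM => /sub.
(* For each subformula and polarity, persistence excludes being forced here but not there; the
   remaining value pairs are enumerated. *)
all: move=> * /=; repeat
  match goal with |- context [sat _ _ ?p true ?X] =>
    move: (P p X); case: (sat _ _ p true X); case: (sat _ _ p false X) => //=;
    try by move/(_ isT) end.
all: by repeat match goal with |- context [sat ?h ?m ?p ?w ?X] => case: (sat h m p w X) end.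
Qed.

Lemma sat_literal H M w (l : literal A) :
  sat H M true w (literal_form l) = (l \in (if w then M else H)).
Proof. by case: l. Qed.

(** What is not forced there is not forced here, so a negation depends on [M] alone. This is why the
    reduct reads negative bodies in [M]. *)
Lemma sat_not H M F :
  H `<=` M -> sat H M true false (Not F) = ~~ sat H M true true F.
Proof.
move=> sHM /=; have := sat_persistent H M true F sHM.
by case: (sat H M true true F); case: (sat H M true false F) => //= ->.
Qed.

Lemma sat_body_conj H M w (s : seq (formula A)) :
  sat H M true w (body_conj s) = all (sat H M true w) s.
Proof.
case: s => [|F s] /=; first by rewrite orbT.
by elim: s F => [|G s IH] F /=; rewrite ?andbT // IH /= andbA.
Qed.

Lemma N2_body_conj T (s : seq (formula A)) :
  (forall F, List.In F s -> N2_derives T F) -> N2_derives T (body_conj s).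
Proof.
case: s => [|F s] /= Ts; first exact: N2_botE.
elim: s F Ts => [|G s IH] F Ts /=; first by apply: Ts; left.
apply: IH => K [<-|sK]; last by apply: Ts; right; right.
apply: N2_mp (Ts G _); last by right; left.
by apply: N2_mp (Ts F _); [exact: N2_andI|left].
Qed.

End HereAndThere.

(** * Answer sets as minimal closed sets of the reduct *)

Section StableModels.
Context {A : choiceType}.
Implicit Types (H M : {fset literal A}) (P : program A) (r : rule A).

Definition holds M (b : basic A) : bool :=
  match b with BTop => true | BBot => false | BLit l => l \in M end.

(* The positive part of the body is read in [H], the negative part in [M]:
   this is truth in [H] of the body in the reduct with respect to [M]. *)
Definition body_holds H M r : bool :=
  all (holds H) (pbody r) && ~~ has (holds M) (nbody r).

Definition reduct_closed P H M : Prop :=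
  forall r, r \in P -> body_holds H M r -> holds H (rhead r).

Definition stable (B : {fset A}) P M : Prop :=
  [/\ M `<=` Lits B, consistent_lits M, reduct_closed P M M
    & forall H, H `<=` M -> reduct_closed P H M -> M `<=` H].

Definition basic_over (B : {fset A}) (b : basic A) : bool :=
  if b is BLit l then l \in Lits B else true.

Definition rule_over (B : {fset A}) r : bool :=
  all (basic_over B) (rhead r :: pbody r ++ nbody r).

Lemma mem_Lits (B : {fset A}) (l : literal A) : (l \in Lits B) = (atom_of l \in B).
Proof.
rewrite /Lits in_fsetU; apply/orP/idP.
  by case=> /imfsetP[a /= aB ->].
by case: l => a /= aB; [left|right]; apply/imfsetP; exists a.
Qed.

Lemma holds_sub H M b : H `<=` M -> holds H b -> holds M b.
Proof. by move=> /fsubsetP sHM; case: b => //= l; exact: sHM. Qed.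

Lemma body_holds_sub H M r : H `<=` M -> body_holds H M r -> body_holds M M r.
Proof.
move=> sHM /andP[Hp nM]; rewrite /body_holds nM andbT.
by apply: sub_all Hp => b; exact: holds_sub.
Qed.

Lemma sat_basic H M w (b : basic A) :
  sat H M true w (basic_form b) = holds (if w then M else H) b.
Proof. by case: b => [||l] /=; rewrite ?orbT ?sat_literal. Qed.

(** An implication forced here must hold at both worlds: the first premise covers there, the second
    covers here. *)
Lemma sat_rule_form H M r : H `<=` M ->
    (body_holds M M r -> holds M (rhead r)) ->
    (body_holds H M r -> holds H (rhead r)) ->
  sat H M true false (rule_form r).
Proof.
move=> sHM rM rH; rewrite /rule_form /= !sat_body_conj !all_cat !all_map !sat_basic /=.
have pE w : all (preim (@basic_form A) (sat H M true w)) (pbody r)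
          = all (holds (if w then M else H)) (pbody r).
  by apply: eq_all => b; exact: sat_basic.
have nE w : all (preim (fun b : basic A => Not (basic_form b)) (sat H M true w)) (nbody r)
          = ~~ has (holds M) (nbody r).
  rewrite -all_predC; apply: eq_all => b /=.
  case: w; first by rewrite sat_basic andbT implybF.
  by have /= -> := sat_not H M (basic_form b) sHM; rewrite sat_basic.
by rewrite !pE !nE; apply/andP; split; apply/implyP.
Qed.

Lemma sat_completion (B : {fset A}) P H M F : H `<=` M ->
    reduct_closed P M M -> reduct_closed P H M ->
  completion B (prog_theory P) M F -> sat H M true false F.
Proof.
move=> sHM cM cH [[r rP ->]|[l lM ->]|[l lM ->]].
- by apply: sat_rule_form => //; [exact: cM|exact: cH].
- by rewrite sat_not // sat_literal; move: lM; rewrite in_fsetD => /andP[].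
- by rewrite sat_not //= sat_literal lM.
Qed.



(** One firing of a rule inside N_2. A negative body literal lies outside [M] but, by [rule_over],
    over [B], so its negation belongs to the completion. *)
Lemma N2_rule_head (B : {fset A}) P M r : r \in P -> rule_over B r ->
    (forall l, BLit l \in pbody r ->
      N2_derives (completion B (prog_theory P) M) (literal_form l)) ->
    body_holds M M r ->
  N2_derives (completion B (prog_theory P) M) (basic_form (rhead r)).
Proof.
move=> rP /allP overB derp /andP[/allP pM /hasPn nM].
apply: (@N2_mp _ _ (body_conj (map (@basic_form A) (pbody r)
  ++ map (fun b => Not (basic_form b)) (nbody r)))).
  by apply: N2_hyp; constructor 1; exists r.
apply: N2_body_conj => F
  /(@List.in_app_or _ _ _ _)[] /(proj1 (List.in_map_iff _ _ _))[b [<- /In_mem bin]].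
  case: b bin (pM _ bin) => [||l] lp //= _; first exact: N2_botE.
  exact: derp.
have : basic_over B b by apply: overB; rewrite inE mem_cat bin !orbT.
case: b bin (nM _ bin) => [||l] ln //= lM lB; first exact: N2_botE.
by apply: N2_hyp; constructor 2; exists l; rewrite // in_fsetD lM.
Qed.

Lemma answer_setE (B : {fset A}) P M :
    (forall r, r \in P -> rule_over B r) ->
  answer_set B (prog_theory P) M <-> stable B P M.
Proof.
move=> overB; split=> [[sMB cM conM derM]|[sMB cM clM minM]].
  have clM : reduct_closed P M M.
    move=> r rP rM; have : basic_over B (rhead r).
      by have /andP[] := overB _ rP.
    have der := N2_rule_head B P M r rP (overB _ rP) _ rM.
    have {der} : N2_derives (completion B (prog_theory P) M) (basic_form (rhead r)).
      by apply: der => l lp; have /andP[/allP pM _] := rM; exact: derM (pM _ lp).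
    case: (rhead r) => [||l] //= der lB.
    (* A derivable head outside [M] would contradict its own negation in the completion. *)
    apply: contraT => lM; exfalso; apply: conM; apply: N2_mp der.
    by apply: N2_hyp; constructor 2; exists l; rewrite // in_fsetD lM.
  split=> // H sHM clH; apply/fsubsetP => l /derM.
  move/(@N2_sound _ H M _ _ sHM cM); rewrite sat_literal; apply.
  by move=> F; exact: sat_completion.
(* The model whose two worlds are both [M] satisfies the completion but not [Bot], whence
   consistency. *)
have satM := @sat_completion B P M M _ (fsubset_refl M) clM clM.
split=> // [derBot|l lM].
  by have := @N2_sound _ M M _ _ (fsubset_refl M) cM satM derBot.
pose H := [fset l in M | `[< N2_derives (completion B (prog_theory P) M) (literal_form l) >]].
have HE k : k \in H = (k \in M) &&
    `[< N2_derives (completion B (prog_theory P) M) (literal_form k) >].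
  by rewrite !inE.
have sHM : H `<=` M by apply/fsubsetP => k; rewrite HE => /andP[].
suff /(minM _ sHM)/fsubsetP/(_ _ lM) : reduct_closed P H M.
  by rewrite HE => /andP[_ /asboolP].
move=> r rP rH; have rM := body_holds_sub _ _ _ sHM rH.
have := clM _ rP rM; have : N2_derives (completion B (prog_theory P) M) (basic_form (rhead r)).
  apply: N2_rule_head => // [|k kp]; first exact: overB.
  have /andP[/allP/(_ _ kp) /= kH _] := rH.
  by move: kH; rewrite HE => /andP[_ /asboolP].
by case: (rhead r) => //= k der kM; rewrite HE kM; apply/asboolP.
Qed.

(** If no rule with a body true in [M] had head [l], then [M] without [l] would still be closed
    under the reduct, against minimality. *)
Lemma stable_supported (B : {fset A}) P M l : stable B P M -> l \in M ->
  exists2 r, r \in P & rhead r = BLit l /\ body_holds M M r.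
Proof.
move=> [_ _ clM minM] lM.
have [/hasP[r rP /andP[/eqP rl rM]]|/hasPn unsup] :=
    boolP (has (fun r => (rhead r == BLit l) && body_holds M M r) P).
  by exists r.
have sub : M `\ l `<=` M by exact: fsubsetDl.
suff /(minM _ sub)/fsubsetP/(_ _ lM) : reduct_closed P (M `\ l) M by rewrite !inE eqxx.
move=> r rP /(body_holds_sub _ _ _ sub) rM.
move: (clM _ rP rM) (unsup _ rP); rewrite rM andbT.
by case: (rhead r) => //= k kM kl; rewrite !inE kM andbT; apply: contra kl => /eqP ->.
Qed.

End StableModels.

(** * Comparison of the two update operators *)

Section Update.
Context {A : choiceType} (P1 P2 : program A).
Implicit Types (H M : {fset literal A}) (K N : {fset literal (xatom A)}).

Local Notation atoms := (prog_atoms (P1 `|` P2)).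
Local Notation "'rej' r" := (PosL (Rej false r)) (at level 10).

Lemma proper_rulesE (P : program A) r :
  (r \in proper_rules P) = (r \in P) && ~~ is_constraint r.
Proof. by rewrite !inE. Qed.

Lemma constraintsE (P : program A) r :
  (r \in constraints P) = (r \in P) && is_constraint r.
Proof. by rewrite !inE. Qed.

Lemma mem_rule_lits (r : rule A) l :
  (l \in rule_lits r) = (BLit l \in rhead r :: pbody r ++ nbody r).
Proof.
rewrite /rule_lits; elim: (rhead r :: _) => [|b s IH] //=.
by case: b => [||k] /=; rewrite !inE ?IH //; congr orb.
Qed.

Lemma mem_prog_lits (P : program A) r l :
  r \in P -> l \in rule_lits r -> l \in prog_lits P.
Proof. by move=> rP lr; apply/imfset2P; exists r => //; exists l. Qed.

Lemma prog_lits_sub (P : program A) l :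
  l \in prog_lits P -> l \in Lits (prog_atoms P).
Proof. by move=> lP; rewrite mem_Lits; apply/imfsetP; exists l. Qed.

Lemma rule_over_prog (P : program A) r : r \in P -> rule_over (prog_atoms P) r.
Proof.
move=> rP; apply/allP => -[||l] //= lr.
by apply: prog_lits_sub; apply: mem_prog_lits rP _; rewrite mem_rule_lits.
Qed.

Lemma basic_over_bcompl (B : {fset A}) b : basic_over B (bcompl b) = basic_over B b.
Proof. by case: b => //= l; rewrite !mem_Lits; case: l. Qed.

Lemma in_xalphabet x : x \in xalphabet P1 P2 =
  match x with
  | Base a => a \in atoms
  | Rej false r => r \in P1
  | Rej true r => r \in P2
  | Idx _ a => a \in atoms
  end.
Proof.
rewrite /xalphabet !in_fsetU; case: x => [a|[] r|[] a]; apply/idP/idP => [|xX].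
all: try by (do ?case/orP; case/imfsetP => y /= yX [] // ->).
all: rewrite -!orbA; repeat (apply/orP; first
  [by left; apply/imfsetP; eexists; last reflexivity|right]).
by apply/imfsetP; exists a.
Qed.

(* The common base literal of the copies of a literal in the extended alphabet;
   on the atoms [Rej _ _] it is [None]. *)
Definition base_lit (x : literal (xatom A)) : option (literal A) :=
  match atom_of x with
  | Base a | Idx _ a => Some (lmap (fun=> a) x)
  | Rej _ _ => None
  end.

(** Indexing the base atom and its two copies by one type lets a single lemma treat all three. *)
Definition copy (o : option bool) : A -> xatom A :=
  if o is Some i then Idx i else @Base A.

Lemma base_litK o l : base_lit (lmap (copy o) l) = Some l.
Proof. by case: o => [i|]; case: l. Qed.

Lemma base_lit_copy x l : base_lit x = Some l -> exists o, x = lmap (copy o) l.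
Proof.
by case: x => -[a|//|i a] [<-]; [exists None|exists (Some i)|exists None|exists (Some i)].
Qed.

(** All three copies of each literal agree with [H]; the [Rej] literals of [K] stay
    unconstrained. *)
Definition reflects K H : Prop := forall o l, (lmap (copy o) l \in K) = (l \in H).

Lemma holds_copy o K H b : reflects K H -> holds K (bmap (copy o) b) = holds H b.
Proof. by move=> E; case: b => //= l; exact: E. Qed.

Lemma body_holds_base K N H M r : reflects K H -> reflects N M ->
  body_holds K N (base_rule r) = body_holds H M r.
Proof.
move=> EH EM; rewrite /body_holds /= all_map has_map; congr (_ && ~~ _).
  by apply: eq_all => b; exact: (holds_copy None).
by apply: eq_has => b; exact: (holds_copy None).
Qed.

Lemma lmap_copy_Lits o l : (lmap (copy o) l \in Lits (xalphabet P1 P2)) = (l \in Lits atoms).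
Proof. by rewrite !mem_Lits; case: o => [i|]; case: l => a; rewrite /= in_xalphabet. Qed.

Lemma bcompl_bmap (B C : Type) (f : B -> C) b : bcompl (bmap f b) = bmap f (bcompl b).
Proof. by case: b => // -[]. Qed.

(** When the copies agree, link and output rules hold trivially, and update rules together with the
    constraints of [P2] amount to [P2] itself. Of the extended alphabet only the rejection atoms
    remain. *)
Lemma reduct_closed_oplus1 K N H M : reflects K H -> reflects N M ->
  reduct_closed (oplus1 P1 P2) K N <->
  [/\ reduct_closed P2 H M, reduct_closed (constraints P1) H M,
      forall r, r \in proper_rules P1 -> body_holds H M r -> rej r \notin N ->
        holds H (rhead r)
    & forall r, r \in proper_rules P1 -> body_holds H M r ->
        holds H (bcompl (rhead r)) -> rej r \in K].
Proof.
move=> EH EM; have bE r := body_holds_base K N H M r EH EM.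
have inertiaE r : body_holds K N (inertia_rule r) = body_holds H M r && (rej r \notin N).
  by rewrite -bE /body_holds /= has_rcons negb_or [X in _ && X]andbC andbA.
have rejectE r : body_holds K N (rejection_rule r)
              = body_holds H M r && holds H (bcompl (rhead r)).
  rewrite -bE /body_holds /= all_rcons bcompl_bmap (holds_copy (Some true) K H) //.
  by rewrite -andbA andbC.
split=> [cl|[cl2 cl1 clI clR] r].
  have mem r : r \in oplus1 P1 P2 -> body_holds K N r -> holds K (rhead r) := cl r.
  split=> r.
  - move=> rP2; rewrite -bE => rH.
    have [cr|cr] := boolP (is_constraint r).
      have : base_rule r \in oplus1 P1 P2.
        rewrite !in_fsetU; do 5 (apply/orP; left).
        by apply/imfsetP; exists r; rewrite //= constraintsE in_fsetU rP2 cr orbT.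
      by move/mem/(_ rH); rewrite /= (holds_copy None K H).
    have : update_rule r \in oplus1 P1 P2.
      rewrite !in_fsetU; do 2 (apply/orP; left); apply/orP; right.
      by apply/imfsetP; exists r; rewrite //= proper_rulesE rP2 cr.
    by move/mem/(_ rH); rewrite /= (holds_copy (Some true) K H).
  - rewrite constraintsE -bE => /andP[rP1 cr] rH.
    have : base_rule r \in oplus1 P1 P2.
      rewrite !in_fsetU; do 5 (apply/orP; left).
      by apply/imfsetP; exists r; rewrite //= constraintsE in_fsetU rP1 cr.
    by move/mem/(_ rH); rewrite /= (holds_copy None K H).
  - move=> rP1 rH rM; have : inertia_rule r \in oplus1 P1 P2.
      rewrite !in_fsetU; do 4 (apply/orP; left); apply/orP; right.
      by apply/imfsetP; exists r.
    by move/mem; rewrite inertiaE rH rM /= (holds_copy (Some false) K H) //; apply.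
  move=> rP1 rH rM; have : rejection_rule r \in oplus1 P1 P2.
    rewrite !in_fsetU; do 3 (apply/orP; left); apply/orP; right.
    by apply/imfsetP; exists r.
  by move/mem; rewrite rejectE rH rM /=; apply.
rewrite !in_fsetU -!orbA => /orP[|/orP[|/orP[|/orP[|/orP[]]]]] /imfsetP[s /= sP ->{r}].
- move: sP; rewrite constraintsE in_fsetU bE => /andP[/orP[sP|sP] cs] sH.
    by rewrite (holds_copy None K H) //; apply: cl1; rewrite // constraintsE sP.
  by rewrite (holds_copy None K H) //; apply: cl2.
- rewrite inertiaE (holds_copy (Some false) K H) // => /andP[]; exact: clI.
- by rewrite rejectE => /andP[]; exact: clR.
- have -> : body_holds K N (update_rule s) = body_holds K N (base_rule s) by [].
  rewrite bE (holds_copy (Some true) K H) //; apply: cl2.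
  by move: sP; rewrite proper_rulesE => /andP[].
- by rewrite /body_holds /= !andbT (EH (Some true)) (EH (Some false)).
- by rewrite /body_holds /= !andbT (EH None) (EH (Some false)).
Qed.

(** Shaped like [reduct_closed_oplus1]: only the clauses for the proper rules of [P1] are left to
    compare. *)
Lemma reduct_closed_oplus2 H M :
  reduct_closed (oplus2 P1 P2) H M <->
  [/\ reduct_closed P2 H M, reduct_closed (constraints P1) H M
    & forall r, r \in proper_rules P1 -> body_holds H M r ->
        ~~ holds M (bcompl (rhead r)) -> holds H (rhead r)].
Proof.
have defE r : body_holds H M (defeasible_rule r)
            = body_holds H M r && ~~ holds M (bcompl (rhead r)).
  by rewrite /body_holds /= has_rcons negb_or [X in _ && X]andbC andbA.
split=> [cl|[cl2 cl1 clD] r].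
  split=> r rP.
  - by apply: cl; rewrite !in_fsetU rP orbT.
  - apply: cl; move: rP; rewrite !in_fsetU !constraintsE in_fsetU.
    by case/andP=> -> ->.
  move=> rH rM; apply: (cl (defeasible_rule r)); last by rewrite defE rH.
  rewrite !in_fsetU; apply/orP; left; apply/orP; right.
  by apply/imfsetP; exists r.
rewrite !in_fsetU constraintsE in_fsetU => /orP[/orP[/andP[/orP[rP|rP] cr]|]|]; last exact: cl2.
- by apply: cl1; rewrite constraintsE rP.
- exact: cl2.
by case/imfsetP => s /= sP ->; rewrite defE => /andP[]; exact: clD.
Qed.

Lemma rule_over_oplus2 r : r \in oplus2 P1 P2 -> rule_over atoms r.
Proof.
rewrite !in_fsetU constraintsE => /orP[/orP[/andP[rP _]|]|rP].
- exact: rule_over_prog.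
- case/imfsetP => s /=; rewrite proper_rulesE => /andP[sP _] ->.
  have : rule_over atoms s by apply: rule_over_prog; rewrite in_fsetU sP.
  by rewrite /rule_over /= all_cat all_cat all_rcons basic_over_bcompl => /and3P[-> -> ->].
by apply: rule_over_prog; rewrite in_fsetU rP orbT.
Qed.

Lemma rule_over_oplus1 r : r \in oplus1 P1 P2 -> rule_over (xalphabet P1 P2) r.
Proof.
have copyE o b : basic_over (xalphabet P1 P2) (bmap (copy o) b) = basic_over atoms b.
  by case: b => //= l; exact: lmap_copy_Lits.
have over s : s \in P1 `|` P2 -> [/\ basic_over atoms (rhead s),
    all (basic_over (xalphabet P1 P2)) (map (bmap (@Base A)) (pbody s))
  & all (basic_over (xalphabet P1 P2)) (map (bmap (@Base A)) (nbody s))].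
  move=> /rule_over_prog; rewrite /rule_over /= all_cat => /and3P[hs ps ns].
  by split=> //; rewrite all_map; [move: ps|move: ns]; apply: sub_all => b /=; rewrite (copyE None).
have rejE s : s \in P1 -> basic_over (xalphabet P1 P2) (rej1 s).
  by move=> sP; rewrite /= mem_Lits in_xalphabet.
rewrite !in_fsetU -!orbA /rule_over.
move=> /orP[|/orP[|/orP[|/orP[|/orP[]]]]] /imfsetP[s /= sP ->{r}] /=.
- move: sP; rewrite constraintsE => /andP[/over[hs ps ns] _].
  by rewrite (copyE None) hs all_cat ps.
- move: sP; rewrite proper_rulesE => /andP[sP _].
  have [|hs ps ns] := over s; first by rewrite in_fsetU sP.
  by rewrite (copyE (Some false)) hs all_cat ps all_rcons rejE.
- move: sP; rewrite proper_rulesE => /andP[sP _].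
  have [|hs ps ns] := over s; first by rewrite in_fsetU sP.
  have /= -> := rejE s sP.
  by rewrite all_cat all_rcons ps ns bcompl_bmap (copyE (Some true)) basic_over_bcompl hs.
- move: sP; rewrite proper_rulesE => /andP[sP _].
  have [|hs ps ns] := over s; first by rewrite in_fsetU sP orbT.
  by rewrite (copyE (Some true)) hs all_cat ps.
- by rewrite (lmap_copy_Lits (Some false)) (lmap_copy_Lits (Some true)) prog_lits_sub.
- by rewrite (lmap_copy_Lits (Some false)) (lmap_copy_Lits None) prog_lits_sub.
Qed.

Lemma mem_base_part (K : {fset literal (xatom A)}) l : K `<=` Lits (xalphabet P1 P2) ->
  (l \in base_part atoms K) = (lmap (copy None) l \in K).
Proof.
move=> /fsubsetP sK; rewrite inE /= inE /=; apply/andP/idP => [[]|lK] //.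
by split; rewrite // -(lmap_copy_Lits None) sK.
Qed.

(** Ensures that every literal over the alphabet, in either sign, has its link and output rules. *)
Lemma tau_prog_lits : tau_comp atoms P2 ->
  forall l, l \in Lits atoms -> l \in prog_lits (P1 `|` P2).
Proof.
move=> tau l lB; apply: (@mem_prog_lits _ (Rule (BLit l) [:: BLit l] [::])).
  by rewrite in_fsetU tau ?orbT.
by rewrite mem_rule_lits inE eqxx.
Qed.

(* The rule [l <- l] of [P2] becomes [l_2 <- l] and closes the loop
   [l -> l_2 -> l_1 -> l]. *)
Lemma reflects_base_part K N : tau_comp atoms P2 -> K `<=` Lits (xalphabet P1 P2) ->
  reduct_closed (oplus1 P1 P2) K N -> reflects K (base_part atoms K).
Proof.
move=> tau sK cl.
have sub o l : lmap (copy o) l \in K -> l \in Lits atoms.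
  by move/fsubsetP: sK => sK /sK; rewrite lmap_copy_Lits.
have out l : lmap (copy (Some false)) l \in K -> lmap (copy None) l \in K.
  move=> lK; apply: (cl (output_rule l)); last by rewrite /body_holds /= lK.
  rewrite !in_fsetU; apply/orP; right; apply/imfsetP; exists l => //.
  exact: tau_prog_lits (sub _ _ lK).
have link l : lmap (copy (Some true)) l \in K -> lmap (copy (Some false)) l \in K.
  move=> lK; apply: (cl (link_rule l)); last by rewrite /body_holds /= lK.
  rewrite !in_fsetU; apply/orP; left; apply/orP; right; apply/imfsetP; exists l => //.
  exact: tau_prog_lits (sub _ _ lK).
have upd l : lmap (copy None) l \in K -> lmap (copy (Some true)) l \in K.
  move=> lK; pose r := Rule (BLit l) [:: BLit l] [::].
  apply: (cl (update_rule r)); last by rewrite /body_holds /= lK.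
  rewrite !in_fsetU; do 2 (apply/orP; left); apply/orP; right; apply/imfsetP; exists r => //=.
  by rewrite proper_rulesE tau // (sub None l).
move=> o l; rewrite mem_base_part //.
case: o => [[]|] //; apply/idP/idP.
- by move/link/out.
- exact: upd.
- exact: out.
- by move/upd/link.
Qed.

(** All other rules have a constant or a copied literal as head, and the atom [Rej false s] records
    its rule [s]. *)
Lemma rej_head r s : r \in oplus1 P1 P2 -> rhead r = BLit (rej s) ->
  s \in proper_rules P1 /\ r = rejection_rule s.
Proof.
rewrite !in_fsetU -!orbA => /orP[|/orP[|/orP[|/orP[|/orP[]]]]] /imfsetP[t /= tP ->{r}] /=.
- by case: (rhead t) => // -[].
- by case: (rhead t) => // -[].
- by case=> <-.
- by case: (rhead t) => // -[].
- by case: t {tP}.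
- by case: t {tP}.
Qed.

Lemma stable_base_part N : tau_comp atoms P2 ->
    stable (xalphabet P1 P2) (oplus1 P1 P2) N ->
  stable atoms (oplus2 P1 P2) (base_part atoms N).
Proof.
move=> tau stN; have [sN cN clN minN] := stN.
set M := base_part atoms N.
have EM : reflects N M by exact: reflects_base_part clN.
have /reduct_closed_oplus1-/(_ M M EM EM)[cl2 cl1 clI clR] := clN.
(* A rejection atom in [N] is supported, necessarily by its rejection rule, whose body contains the
   complement of the head. *)
have rejP r : rej r \in N -> holds M (bcompl (rhead r)).
  move=> rN; have [q qP [/(rej_head _ _ qP)[rP ->]]] := stable_supported _ _ _ _ stN rN.
  case/andP; rewrite /= all_rcons bcompl_bmap => /andP[].
  by rewrite (holds_copy (Some true) N M).
split.
- by apply/fsubsetP => l; rewrite /M !inE => /andP[].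
- move=> l; rewrite -!(EM None) => /cN.
  by case: l.
- apply/reduct_closed_oplus2; split=> // r rP rM nM.
  by apply: clI => //; apply: contra nM; exact: rejP.
move=> H sH /reduct_closed_oplus2[h2 h1 hD].
(* [H] is lifted by restricting the copies in [N] to [H] while keeping every rejection literal of
   [N]. *)
pose K := [fset x in N | if base_lit x is Some l then l \in H else true].
have KE x : x \in K = (x \in N) && (if base_lit x is Some l then l \in H else true).
  by rewrite !inE.
have EK : reflects K H.
  move=> o l; rewrite KE base_litK EM andb_idl //.
  by move/fsubsetP: sH; apply.
suff /minN : reduct_closed (oplus1 P1 P2) K N.
  have sK : K `<=` N by apply/fsubsetP => x; rewrite KE => /andP[].
  move=> /(_ sK)/fsubsetP sNK; apply/fsubsetP => l.
  by rewrite -(EM None) -(EK None); exact: sNK.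
apply/(reduct_closed_oplus1 K N H M EK EM); split=> // r rP rH.
(* The body of [r] holds in [H], hence in [M]; if the complement of the head were in [M] as well,
   [r] would be rejected in [N]. *)
- move=> rN; apply: hD => //; apply: contra rN.
  by apply: clR => //; exact: body_holds_sub rH.
- by move=> hH; rewrite KE /= andbT; apply: clR;
    rewrite ?(body_holds_sub _ _ _ sH rH) ?(holds_sub _ _ _ sH).
Qed.

Lemma stable_extension M : tau_comp atoms P2 -> stable atoms (oplus2 P1 P2) M ->
  exists2 N, stable (xalphabet P1 P2) (oplus1 P1 P2) N & M = base_part atoms N.
Proof.
move=> tau [sM cM /reduct_closed_oplus2[cl2 cl1 clD] minM].
pose rejected r := [&& r \in proper_rules P1, body_holds M M r & holds M (bcompl (rhead r))].
(* All copies of [M], plus the atoms of the rejected rules. Other [Rej] literals are left out, as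
   they head no rule. *)
pose N := [fset x in Lits (xalphabet P1 P2) |
  if base_lit x is Some l then l \in M
  else if x is PosL (Rej false r) then rejected r else false].
have NE x : x \in N = (x \in Lits (xalphabet P1 P2)) &&
    (if base_lit x is Some l then l \in M
     else if x is PosL (Rej false r) then rejected r else false).
  by rewrite !inE.
have sN : N `<=` Lits (xalphabet P1 P2) by apply/fsubsetP => x; rewrite NE => /andP[].
have EM : reflects N M.
  move=> o l; rewrite NE base_litK lmap_copy_Lits andb_idl //.
  by move/fsubsetP: sM; apply.
have rejE r : rej r \in N = rejected r.
  rewrite NE /= andb_idl // => /and3P[]; rewrite proper_rulesE => /andP[rP _] _ _.
  by rewrite mem_Lits in_xalphabet.
have MN : M = base_part atoms N.
  by apply/fsetP => l; rewrite mem_base_part // EM.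
exists N => //; split=> //.
- move=> x; rewrite !NE => /andP[_ xN]; rewrite negb_and; apply/orP; right.
  by case: x xN => -[a|[] r|i a] //= /cM.
- apply/(reduct_closed_oplus1 N N M M EM EM); split=> // r rP rM.
    by rewrite rejE /rejected rP rM; exact: clD.
  by move=> hM; rewrite rejE /rejected rP rM.
move=> K sK clK.
set H := base_part atoms K.
have EK : reflects K H.
  by apply: reflects_base_part clK => //; exact: fsubset_trans sN.
have sH : H `<=` M.
  by apply/fsubsetP => l; rewrite -(EK None) -(EM None); move/fsubsetP: sK; apply.
have /(reduct_closed_oplus1 K N H M EK EM)[h2 h1 hI hR] := clK.
(* A rule whose head has its complement outside [M] is not rejected, so its inertia rule fires in
   [K]; thus [H] is closed for [oplus2] and minimality of [M] applies. *)
have HM : H = M.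
  apply/eqP; rewrite eqEfsubset sH; apply: minM => //.
  apply/reduct_closed_oplus2; split=> // r rP rH nM.
  by apply: hI => //; rewrite rejE /rejected (negbTE nM) !andbF.
(* With [H = M], [K] has all copies of [M], and its rejection clause yields every rejection atom of
   [N]. *)
rewrite HM in EK hR; apply/fsubsetP => x; rewrite NE => /andP[_].
case xl : (base_lit x) => [l|]; first by have [o ->] := base_lit_copy _ _ xl; rewrite EK.
by case: x xl => -[|[]|] // r _ /and3P[]; exact: hR.
Qed.

End Update.

Theorem theorem4p4 (A : choiceType) (P1 P2 : program A)
    (hP2 : tau_comp (prog_atoms (P1 `|` P2)) P2) (S : {fset literal A}) :
  update_answer_set P1 P2 S <->
  answer_set (prog_atoms (P1 `|` P2)) (prog_theory (oplus2 P1 P2)) S.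
Proof.
have over1 := @rule_over_oplus1 A P1 P2; have over2 := @rule_over_oplus2 A P1 P2.
split=> [[N /(answer_setE _ _ _ over1) stN ->]|/(answer_setE _ _ _ over2) stS].
  by apply/(answer_setE _ _ _ over2); exact: stable_base_part.
have [N stN ->] := stable_extension P1 P2 S hP2 stS.
by exists N => //; apply/(answer_setE _ _ _ over1).
Qed.
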